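(* Let $m$ and $n$ be two positive integers with $n\ge m$, and let $T_n$ denote the Chebyshev polynomials of the first kind. The coefficients $\widetilde\rho_{j,n}^{\,m}$, $0\le j\le m+n+1$, in the expansion $$\int_{-1}^{x+1}T_m(x-t)T_n(t)\,dt=\sum_{k=0}^{m+n+1}\widetilde\rho_{k,n}^{\,m}T_k(x+1)$$ can be expressed as $$\widetilde\rho_{j,n}^{\,m}=\sum_{\nu=\max(1,|j-n|)}^{m+1}\widetilde\varpi_{j,\nu}^{m,n}\quad\text{for } j\ge\max(m+1,n-m-1),$$ $$\widetilde\rho_{j,n}^{\,m}=0\quad\text{for } m+1\le j\le n-m-2,\ \text{if } n\ge2m+3,$$ $$\widetilde\rho_{j,n}^{\,m}=\sum_{\nu=1}^j\widetilde\varpi_{j,\nu}^{n,m}+\sum_{\nu=j+1}^{n+1}\widetilde d_{\nu,j,n}^{\,m}\quad\text{for }0\le j\le m,$$ where $$\widetilde\varpi_{j,\nu}^{m,n}=\frac{(-1)^m\,2^{1-2\nu}\,n\,(-m)_{\nu-1}(m)_{\nu-1}(-\nu)_{\frac{n+\nu-j}{2}}\left(\frac{n+\nu-j+2}{2}\right)_{j-\nu-1}}{(1/2)_{\nu-1}\left(\frac{n+\nu+j}{2}\right)!}$$ for even $n+\nu-j$ and $\widetilde\varpi_{j,\nu}^{m,n}=0$ otherwise (with $\widetilde\varpi_{j,\nu}^{n,m}$ obtained by interchanging $m$ and $n$ throughout, including in the parity condition), and $$\widetilde d_{\nu,j,n}^{\,m}=\frac{2^{2-\delta_{0,j}}(-1)^{m+n}(-n)_{\nu-1}(n)_{\nu-1}(\nu-1/2)}{(\nu-j)!\,(j+\nu)!}\;{}_4F_3\!\left({1,\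 -m,\ m,\ \nu+1/2\atop1/2,\ -j+\nu+1,\ j+\nu+1};1\right).$$
   Context: $(z)_0=1$, $(z)_N=\prod_{\sigma=0}^{N-1}(z+\sigma)$ for $N\ge1$, and for negative integer index $(z)_{N}=\Gamma(z+N)/\Gamma(z)$ (so $(z)_{-1}=1/(z-1)$). $\delta_{0,j}$ is the Kronecker delta. The generalized hypergeometric series is ${}_pF_q\left({a_1,\ldots,a_p\atop b_1,\ldots,b_q};x\right)=\sum_{N\ge0}\frac{(a_1)_N\cdots(a_p)_N}{(b_1)_N\cdots(b_q)_N}\frac{x^N}{N!}$. $T_n$ is determined by $P_n^{(-1/2,-1/2)}(x)=\frac{(1/2)_n}{n!}T_n(x)$, where $P_n^{(\alpha,\beta)}$ are the Jacobi polynomials, i.e. $T_n(\cos\theta)=\cos n\theta$. Empty sums are zero. *)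

(* Defs.v *)
From Stdlib Require Import Reals Lra Lia ZArith List.
From Coquelicot Require Import Coquelicot.
Import ListNotations.
Open Scope R_scope.

Fixpoint rising (z : R) (N : nat) : R :=
  match N with
  | O => 1
  | S N' => rising z N' * (z + INR N')
  end.

(* For a negative index N = -p, Gamma (z + N) / Gamma z is by the functional
   equation 1 / ((z - p) (z - p + 1) ... (z - 1)); see [poch_Gamma]. *)
Definition poch (z : R) (N : Z) : R :=
  match N with
  | Zneg p => / rising (z + IZR N) (Pos.to_nat p)
  | _ => rising z (Z.to_nat N)
  end.

Definition Rprod (l : list R) : R := fold_right Rmult 1 l.

Definition pFq (a b : list R) (x : R) : R :=
  Series (fun N : nat =>
    Rprod (map (fun z => poch z (Z.of_nat N)) a)
    / Rprod (map (fun z => poch z (Z.of_nat N)) b)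
    * (x ^ N / INR (fact N))).

Definition jacobi (al be : R) (n : nat) (x : R) : R :=
  poch (al + 1) (Z.of_nat n) / INR (fact n)
  * pFq [- INR n; INR n + al + be + 1] [al + 1] ((1 - x) / 2).

(* The normalisation P_n^(-1/2,-1/2) = (1/2)_n / n! T_n; see [chebT_cos]. *)
Definition chebT (n : nat) (x : R) : R :=
  jacobi (- (1 / 2)) (- (1 / 2)) n x
  / (poch (1 / 2) (Z.of_nat n) / INR (fact n)).

(* RInt is oriented, so x + 1 < -1 is allowed; both sides are polynomial in x. *)
Definition conv_expansion (m n : nat) (rho : nat -> R) : Prop :=
  forall x : R,
    RInt (fun t => chebT m (x - t) * chebT n t) (-1) (x + 1)
    = sum_n (fun k => rho k * chebT k (x + 1)) (m + n + 1).

Definition varpi (m n j nu : nat) : R :=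
  let M := Z.of_nat m in
  let N := Z.of_nat n in
  let J := Z.of_nat j in
  let V := Z.of_nat nu in
  if Z.even (N + V - J) then
    (-1) ^ m * powerRZ 2 (1 - 2 * V) * INR n
    * poch (- INR m) (V - 1) * poch (INR m) (V - 1)
    * poch (- INR nu) ((N + V - J) / 2)
    * poch (IZR (N + V - J + 2) / 2) (J - V - 1)
    / (poch (1 / 2) (V - 1) * INR (fact (Z.to_nat ((N + V + J) / 2))))
  else 0.

(* d_{nu,j,n}^m, used only for nu > j. *)
Definition dtil (m n j nu : nat) : R :=
  let V := Z.of_nat nu in
  2 ^ (2 - (if Nat.eqb 0 j then 1 else 0)) * (-1) ^ (m + n)
  * poch (- INR n) (V - 1) * poch (INR n) (V - 1) * (INR nu - 1 / 2)
  / (INR (fact (nu - j)) * INR (fact (j + nu)))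
  * pFq [1; - INR m; INR m; INR nu + 1 / 2]
        [1 / 2; - INR j + INR nu + 1; INR j + INR nu + 1] 1.

Lemma rising_S_l (z : R) (N : nat) : rising z (S N) = z * rising (z + 1) N.
Proof.
induction N as [|N IH]; [simpl; ring|].
change (rising z (S N) * (z + INR (S N))
        = z * (rising (z + 1) N * (z + 1 + INR N))).
rewrite IH, S_INR; ring.
Qed.

Lemma rising_Gamma (G : R -> R)
  (G_rec : forall w, (forall p : nat, w <> - INR p) -> G (w + 1) = w * G w)
  (z : R) (N : nat) :
  (forall p : nat, z <> - INR p) -> G (z + INR N) = rising z N * G z.
Proof.
intros Hz; induction N as [|N IH].
  simpl; rewrite Rplus_0_r; ring.
rewrite S_INR.
replace (z + (INR N + 1)) with (z + INR N + 1) by ring.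
rewrite G_rec, IH; [simpl; ring|].
intros p Hp; apply (Hz (p + N)%nat); rewrite plus_INR; lra.
Qed.

Lemma poch_Gamma (G : R -> R)
  (G_rec : forall w, (forall p : nat, w <> - INR p) -> G (w + 1) = w * G w)
  (z : R) (N : Z) :
  (forall p : nat, z <> - INR p) -> (forall p : nat, z + IZR N <> - INR p) ->
  G z <> 0 -> poch z N = G (z + IZR N) / G z.
Proof.
intros Hz HzN Gz.
assert (Hnneg : forall k : nat, rising z k = G (z + INR k) / G z).
  intros k; rewrite (rising_Gamma G G_rec z k Hz); field; exact Gz.
destruct N as [|p|p]; unfold poch.
- rewrite Hnneg; reflexivity.
- rewrite Hnneg, INR_IZR_INZ, Z2Nat.id by lia; reflexivity.
- pose proof (rising_Gamma G G_rec _ (Pos.to_nat p) HzN) as H.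
  assert (E : IZR (Z.neg p) = - INR (Pos.to_nat p)).
    rewrite INR_IZR_INZ, positive_nat_Z, <- opp_IZR; reflexivity.
  rewrite E in *.
  replace (z + - INR (Pos.to_nat p) + INR (Pos.to_nat p)) with z in H by ring.
  rewrite H in Gz |- *.
  field; split; intros H0; apply Gz; rewrite H0; ring.
Qed.

Lemma poch_nat (z : R) (N : nat) : poch z (Z.of_nat N) = rising z N.
Proof.
unfold poch; destruct N as [|N]; [reflexivity|].
change (rising z (Z.to_nat (Z.of_nat (S N))) = rising z (S N)).
rewrite Nat2Z.id; reflexivity.
Qed.

Lemma rising_pos (z : R) (N : nat) : 0 < z -> 0 < rising z N.
Proof.
intros Hz; induction N as [|N IH]; simpl; [lra|].
apply Rmult_lt_0_compat; [exact IH|]; pose proof (pos_INR N); lra.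
Qed.

Lemma rising_opp_nat (n k : nat) : (n < k)%nat -> rising (- INR n) k = 0.
Proof.
induction 1 as [|k Hk IH]; simpl; [ring|rewrite IH; ring].
Qed.

Lemma Series_finite (a : nat -> R) (n : nat) :
  (forall k, (n < k)%nat -> a k = 0) -> Series a = sum_n a n.
Proof.
intros Ha; apply is_series_unique.
change (is_lim_seq (sum_n a) (sum_n a n)).
apply (is_lim_seq_ext_loc (fun _ => sum_n a n)); [|apply is_lim_seq_const].
exists n; intros k Hk; induction Hk as [|k Hk IH]; [reflexivity|].
rewrite sum_Sn, <- IH, Ha by lia.
unfold plus; simpl; rewrite Rplus_0_r; reflexivity.
Qed.

Definition cheb_coef (z : R) (k : nat) : R :=
  rising (- z) k * rising z k / (rising (1 / 2) k * INR (fact k)).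

Lemma cheb_coef_zero (n k : nat) : (n < k)%nat -> cheb_coef (INR n) k = 0.
Proof.
intros H; unfold cheb_coef; rewrite (rising_opp_nat n k H); unfold Rdiv; ring.
Qed.

Lemma cheb_coef_rec (z : R) (k : nat) :
  cheb_coef (z + 1) (S k) + cheb_coef (z - 1) (S k)
  = 2 * cheb_coef z (S k) - 4 * cheb_coef z k.
Proof.
unfold cheb_coef.
destruct k as [|k].
  simpl; field.
assert (Hf := INR_fact_neq_0 k).
assert (Hk := pos_INR k).
assert (Hr : rising (1 / 2) k <> 0) by (apply Rgt_not_eq, rising_pos; lra).
assert (E1 : rising (- (z + 1)) (S (S k)) = (- z - 1) * (- z) * rising (- z + 1) k).
  rewrite !rising_S_l.
  replace (- (z + 1) + 1 + 1) with (- z + 1) by ring; ring.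
assert (E2 : rising (z - 1) (S (S k)) = (z - 1) * z * rising (z + 1) k).
  rewrite !rising_S_l.
  replace (z - 1 + 1 + 1) with (z + 1) by ring; ring.
rewrite E1, E2.
rewrite (rising_S_l (- z)), (rising_S_l z), (rising_S_l (- z) k), (rising_S_l z k).
replace (- (z - 1)) with (- z + 1) by ring.
rewrite !fact_simpl, !mult_INR.
cbn [rising]; rewrite !S_INR.
field; repeat split; lra.
Qed.

Lemma chebT_sum (n N : nat) (x : R) : (n <= N)%nat ->
  chebT n x = sum_n (fun k => cheb_coef (INR n) k * ((1 - x) / 2) ^ k) N.
Proof.
intros HN; unfold chebT, jacobi, pFq.
replace (- (1 / 2) + 1) with (1 / 2) by field.
replace (INR n + - (1 / 2) + - (1 / 2) + 1) with (INR n) by field.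
rewrite <- (Series_finite _ N).
  rewrite poch_nat.
  rewrite (Series_ext _ (fun k => cheb_coef (INR n) k * ((1 - x) / 2) ^ k)).
    assert (Hr : rising (1 / 2) n <> 0) by (apply Rgt_not_eq, rising_pos; lra).
    assert (Hf := INR_fact_neq_0 n).
    field; split; assumption.
  intros k; unfold cheb_coef, Rprod; cbn [map fold_right]; rewrite !poch_nat.
  assert (Hr : rising (1 / 2) k <> 0) by (apply Rgt_not_eq, rising_pos; lra).
  assert (Hf := INR_fact_neq_0 k).
  field; split; assumption.
intros k Hk; rewrite cheb_coef_zero by lia; ring.
Qed.

Lemma chebT_rec (n : nat) (x : R) :
  chebT (S (S n)) x = 2 * x * chebT (S n) x - chebT n x.
Proof.
set (u := (1 - x) / 2).
assert (Hx : x = 1 - 2 * u) by (unfold u; field).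
rewrite (chebT_sum (S (S n)) (S (S n))), (chebT_sum n (S (S n))) by lia.
assert (E : forall N, sum_n (fun k => cheb_coef (INR (S (S n))) k * u ^ k) (S N)
   = 2 * sum_n (fun k => cheb_coef (INR (S n)) k * u ^ k) (S N)
     - 4 * u * sum_n (fun k => cheb_coef (INR (S n)) k * u ^ k) N
     - sum_n (fun k => cheb_coef (INR n) k * u ^ k) (S N)).
  assert (R1 : INR (S (S n)) = INR (S n) + 1) by (rewrite (S_INR (S n)); ring).
  assert (R0 : INR n = INR (S n) - 1) by (rewrite S_INR; ring).
  intros N; induction N as [|N IH].
    rewrite !sum_Sn, !sum_O; unfold plus; cbn [AbelianMonoid.plus].
    pose proof (cheb_coef_rec (INR (S n)) 0) as H.
    rewrite <- R1, <- R0 in H.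
    replace (cheb_coef (INR (S (S n))) 1) with
      (2 * cheb_coef (INR (S n)) 1 - 4 * cheb_coef (INR (S n)) 0
       - cheb_coef (INR n) 1) by lra.
    assert (C0 : forall z, cheb_coef z 0 = 1) by (intros z; unfold cheb_coef; simpl; field).
    rewrite !C0; simpl; ring.
  rewrite (sum_Sn _ (S N)), IH, (sum_Sn (fun k => cheb_coef (INR (S n)) k * u ^ k) (S N)),
    (sum_Sn (fun k => cheb_coef (INR n) k * u ^ k) (S N)),
    (sum_Sn (fun k => cheb_coef (INR (S n)) k * u ^ k) N).
  pose proof (cheb_coef_rec (INR (S n)) (S N)) as H.
  rewrite <- R1, <- R0 in H.
  replace (cheb_coef (INR (S (S n))) (S (S N))) with
      (2 * cheb_coef (INR (S n)) (S (S N)) - 4 * cheb_coef (INR (S n)) (S N)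
       - cheb_coef (INR n) (S (S N))) by lra.
  unfold plus; simpl; ring.
fold u; rewrite E.
rewrite (chebT_sum (S n) (S n) x) by lia; fold u.
replace (sum_n (fun k => cheb_coef (INR (S n)) k * u ^ k) (S (S n)))
  with (sum_n (fun k => cheb_coef (INR (S n)) k * u ^ k) (S n)).
  rewrite Hx; ring.
rewrite (sum_Sn _ (S n)), cheb_coef_zero by lia.
unfold plus; simpl; rewrite Rmult_0_l, Rplus_0_r; reflexivity.
Qed.

Lemma chebT_0 (x : R) : chebT 0 x = 1.
Proof.
rewrite (chebT_sum 0 0) by lia; rewrite sum_O; unfold cheb_coef; simpl; field.
Qed.

Lemma chebT_1 (x : R) : chebT 1 x = x.
Proof.
rewrite (chebT_sum 1 1) by lia; rewrite sum_Sn, sum_O.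
unfold plus, cheb_coef; simpl; field.
Qed.

Theorem chebT_cos (n : nat) (theta : R) : chebT n (cos theta) = cos (INR n * theta).
Proof.
enough (H : chebT n (cos theta) = cos (INR n * theta)
            /\ chebT (S n) (cos theta) = cos (INR (S n) * theta)) by apply H.
induction n as [|n [IH0 IH1]].
  split; [rewrite chebT_0|rewrite chebT_1]; simpl.
    rewrite Rmult_0_l, cos_0; reflexivity.
  rewrite Rmult_1_l; reflexivity.
split; [exact IH1|].
rewrite chebT_rec, IH0, IH1.
set (b := INR (S n) * theta).
replace (INR n * theta) with (b - theta) by (unfold b; rewrite S_INR; ring).
replace (INR (S (S n)) * theta) with (b + theta)
  by (unfold b; rewrite (S_INR (S n)); ring).
rewrite cos_plus, cos_minus; ring.
Qed.

(* Main.v *)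
(** Expanding [T_m (x - t)] and [T_n t] in powers of [y - t] and [1 + t], with
    [y = x + 1], and applying the beta integral turns the convolution into a
    double sum of divided powers [(1 + y)^N / N!], [N = i + k + 1], symmetric in
    [m] and [n].  The Chebyshev coefficients of divided powers are central
    binomial coefficients.  Summing over [k] alone gives the coefficients of the
    [nu]-fold iterated integral of [T_n], [nu = i + 1].  For [j >= nu] these are
    determined by the integration rule [2 j a_j = b_(j-1) - b_(j+1)], starting
    from the Kronecker delta, which yields [varpi]; for [j < nu] the sum itself
    is the [4F3] of [dtil].  For [j <= m] one uses the symmetry in [m] and [n]. *)

Require Import Defs.
From Stdlib Require Import Reals ZArith Lra Lia List.
From Coquelicot Require Import Coquelicot.
Import ListNotations.
Open Scope R_scope.

(** * Finite sums of reals *)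

Lemma sum_n_Rext (f g : nat -> R) (N : nat) :
  (forall k, (k <= N)%nat -> f k = g k) -> sum_n f N = sum_n g N :> R.
Proof. exact (sum_n_ext_loc f g N). Qed.

Lemma sum_n_S (f : nat -> R) (N : nat) : sum_n f (S N) = sum_n f N + f (S N) :> R.
Proof. exact (sum_Sn f N). Qed.

Lemma sum_n_Rmult_l (c : R) (f : nat -> R) (N : nat) :
  sum_n (fun k => c * f k) N = c * sum_n f N :> R.
Proof. exact (sum_n_mult_l c f N). Qed.

Lemma sum_n_Rmult_r (c : R) (f : nat -> R) (N : nat) :
  sum_n (fun k => f k * c) N = sum_n f N * c :> R.
Proof. exact (sum_n_mult_r c f N). Qed.

Lemma sum_n_Rplus (f g : nat -> R) (N : nat) :
  sum_n (fun k => f k + g k) N = sum_n f N + sum_n g N :> R.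
Proof. exact (sum_n_plus f g N). Qed.

Lemma sum_n_Rminus (f g : nat -> R) (N : nat) :
  sum_n (fun k => f k - g k) N = sum_n f N - sum_n g N :> R.
Proof.
induction N as [|N IH]; [rewrite !sum_O|rewrite !sum_n_S, IH]; ring.
Qed.

Lemma sum_n_indicator (f : nat -> R) (n N : nat) : (n <= N)%nat ->
  sum_n (fun k => (if Nat.eqb k n then 1 else 0) * f k) N = f n :> R.
Proof.
intros H.
assert (E : forall M, sum_n (fun k => (if Nat.eqb k n then 1 else 0) * f k) M
                      = (if Nat.leb n M then f n else 0) :> R).
  intros M; induction M as [|M IH].
    rewrite sum_O; destruct n; simpl; ring.
  rewrite sum_n_S, IH.
  destruct (Nat.eqb_spec (S M) n), (Nat.leb_spec n M), (Nat.leb_spec n (S M));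
    try lia; subst; ring.
rewrite E; destruct (Nat.leb_spec n N); [reflexivity|lia].
Qed.

Lemma is_RInt_sum_n (f : nat -> R -> R) (l : nat -> R) (a b : R) (N : nat) :
  (forall k, is_RInt (f k) a b (l k)) ->
  is_RInt (fun t => sum_n (fun k => f k t) N) a b (sum_n l N).
Proof.
intros H; induction N as [|N IH].
  rewrite sum_O; apply is_RInt_ext with (2 := H 0%nat).
  intros t _; rewrite sum_O; reflexivity.
rewrite sum_n_S.
apply is_RInt_ext with (2 := is_RInt_plus _ _ _ _ _ _ IH (H (S N))).
intros t _; rewrite sum_n_S; reflexivity.
Qed.

(** * Rising factorials and factorials *)

Lemma rising_add (z : R) (a b : nat) :
  rising z (a + b) = rising z a * rising (z + INR a) b.
Proof.
induction b as [|b IH].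
  rewrite Nat.add_0_r; simpl; ring.
rewrite Nat.add_succ_r; simpl; rewrite IH, plus_INR; ring.
Qed.

Lemma rising_fact (a k : nat) :
  rising (INR a + 1) k = INR (fact (a + k)) / INR (fact a).
Proof.
assert (Ha := INR_fact_neq_0 a).
induction k as [|k IH].
  rewrite Nat.add_0_r; simpl; field; exact Ha.
rewrite Nat.add_succ_r, fact_simpl, mult_INR, S_INR, plus_INR; simpl; rewrite IH.
field; exact Ha.
Qed.

Lemma rising_half_neq_0 (k : nat) : rising (1 / 2) k <> 0.
Proof. apply Rgt_not_eq, rising_pos; lra. Qed.

(** The sign turns the rising factorial of [- N] into the falling factorial
    [N (N - 1) ... (N - j + 1)]. *)
Lemma rising_opp_fact (N j : nat) : (j <= N)%nat ->
  (-1) ^ j * rising (- INR N) j = INR (fact N) / INR (fact (N - j)).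
Proof.
induction j as [|j IH]; intros H.
  rewrite Nat.sub_0_r; simpl; field; apply INR_fact_neq_0.
replace ((-1) ^ S j * rising (- INR N) (S j))
  with ((-1) ^ j * rising (- INR N) j * (INR N - INR j)) by (simpl; ring).
rewrite IH by lia.
replace (N - j)%nat with (S (N - S j)) by lia.
rewrite fact_simpl, mult_INR.
replace (S (N - S j)) with (N - j)%nat by lia.
rewrite minus_INR by lia.
assert (INR j < INR N) by (apply lt_INR; lia).
field; split; [apply INR_fact_neq_0|lra].
Qed.

(** * Taylor expansion of Chebyshev polynomials at -1 *)

Definition divided_pow (N : nat) (y : R) : R := (1 + y) ^ N / INR (fact N).

(* [(-1)^n] times the [k]-th derivative of [T_n] at [-1]. *)
Definition taylor_coef (n k : nat) : R :=
  rising (- INR n) k * rising (INR n) k / (rising (1 / 2) k * 2 ^ k).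

Lemma chebT_opp (n : nat) (x : R) : chebT n (- x) = (-1) ^ n * chebT n x.
Proof.
enough (H : chebT n (- x) = (-1) ^ n * chebT n x
            /\ chebT (S n) (- x) = (-1) ^ S n * chebT (S n) x) by apply H.
induction n as [|n [IH0 IH1]].
  split; rewrite ?chebT_0, ?chebT_1; simpl; ring.
split; [exact IH1|].
rewrite !chebT_rec, IH0, IH1; simpl; ring.
Qed.

(** The hypergeometric definition is an expansion at 1; the parity of [T_n] moves the centre to -1
    and produces the sign [(-1)^n]. *)
Lemma chebT_taylor (n : nat) (x : R) :
  chebT n x = (-1) ^ n * sum_n (fun k => taylor_coef n k * divided_pow k x) n.
Proof.
replace x with (- - x) at 1 by ring.
rewrite chebT_opp, (chebT_sum n n) by lia; f_equal.
apply sum_n_Rext; intros k _; unfold cheb_coef, taylor_coef, divided_pow.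
replace ((1 - - x) / 2) with ((1 + x) * / 2) by field.
rewrite Rpow_mult_distr, pow_inv.
assert (H2 : 2 ^ k <> 0) by (apply pow_nonzero; lra).
field; repeat split; [apply INR_fact_neq_0|exact H2|apply rising_half_neq_0].
Qed.

(** * Linear independence of Chebyshev polynomials *)

Lemma chebT_free (N : nat) (r : nat -> R) :
  (forall y, sum_n (fun k => r k * chebT k y) N = 0) ->
  forall k, (k <= N)%nat -> r k = 0.
Proof.
intros H.
assert (Hcos : forall t, sum_n (fun k => r k * cos (INR k * t)) N = 0).
  intros t; rewrite <- (H (cos t)); apply sum_n_Rext; intros k _.
  rewrite chebT_cos; reflexivity.
clear H; revert r Hcos; induction N as [|N IH]; intros r Hcos.
  intros k Hk; replace k with 0%nat by lia.
  generalize (Hcos 0); rewrite sum_O, Rmult_0_r, cos_0; lra.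
(* The shifts by [+h] and [-h] add up to multiplication of the [k]-th term by
   [2 cos (k h)]; with [h = PI / (N + 1)] this eliminates the top term only. *)
set (h := PI / INR (S N)).
assert (HN : 0 < INR (S N)) by (apply lt_0_INR; lia).
assert (Hlow : forall k, (k <= N)%nat -> r k = 0).
  intros k Hk.
  assert (Hk' : r k * (cos (INR k * h) + 1) = 0).
    apply (IH (fun k => r k * (cos (INR k * h) + 1))); [|exact Hk].
    intros t.
    assert (E : sum_n (fun k => r k * (cos (INR k * h) + 1) * cos (INR k * t)) (S N)
      = (sum_n (fun k => r k * cos (INR k * (t + h))) (S N)
         + sum_n (fun k => r k * cos (INR k * (t - h))) (S N)) / 2
        + sum_n (fun k => r k * cos (INR k * t)) (S N)).
      unfold Rdiv; rewrite <- sum_n_Rplus, <- sum_n_Rmult_r, <- sum_n_Rplus.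
      apply sum_n_Rext; intros i _.
      rewrite (Rmult_minus_distr_l (INR i)), (Rmult_plus_distr_l (INR i)).
      rewrite cos_plus, cos_minus; field.
    rewrite !Hcos, sum_n_S in E.
    replace (INR (S N) * h) with PI in E by (unfold h; field; lra).
    rewrite cos_PI in E; lra.
  (* The second factor cannot vanish: [0 <= k h < PI], and cosine decreases on [[0, PI]], so
     [cos (k h) > -1]. *)
  apply Rmult_integral in Hk'; destruct Hk' as [Hk'|Hk']; [exact Hk'|exfalso].
  assert (Hlt : INR k * h < PI).
    unfold h; apply Rmult_lt_reg_r with (INR (S N)); [exact HN|].
    replace (INR k * (PI / INR (S N)) * INR (S N)) with (PI * INR k) by (field; lra).
    apply Rmult_lt_compat_l; [exact PI_RGT_0|apply lt_INR; lia].
  assert (Hge : 0 <= INR k * h).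
    apply Rmult_le_pos; [apply pos_INR|].
    apply Rlt_le, Rdiv_lt_0_compat; [exact PI_RGT_0|exact HN].
  assert (cos PI < cos (INR k * h)) by
    (apply cos_decreasing_1; pose proof PI_RGT_0; lra).
  rewrite cos_PI in *; lra.
intros k Hk; destruct (Nat.eq_dec k (S N)) as [->|Hne]; [|apply Hlow; lia].
generalize (Hcos 0); rewrite sum_n_S, Rmult_0_r, cos_0.
rewrite (sum_n_Rext _ (fun k => 0 * 0)).
  rewrite sum_n_Rmult_l; lra.
intros i Hi; rewrite Hlow by lia; ring.
Qed.

Lemma chebT_coef_unique (N : nat) (r s : nat -> R) :
  (forall y, sum_n (fun k => r k * chebT k y) N = sum_n (fun k => s k * chebT k y) N) ->
  forall k, (k <= N)%nat -> r k = s k.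
Proof.
intros H k Hk; apply Rminus_diag_uniq.
apply (chebT_free N (fun k => r k - s k)); [|exact Hk].
intros y; rewrite <- (Rminus_diag_eq _ _ (H y)), <- sum_n_Rminus.
apply sum_n_Rext; intros i _; ring.
Qed.

(** * Chebyshev coefficients of divided powers *)

(* Half the coefficient of [T_j], [j > 0], in [divided_pow N]; it equals
   [2^N (1/2)_N / ((N-j)! (N+j)!)], written so as to vanish for [j > N]. *)
Definition half_coef (N j : nat) : R :=
  2 ^ N * rising (1 / 2) N * ((-1) ^ j * rising (- INR N) j)
  / (INR (fact N) * INR (fact (N + j))).

Lemma half_coef_gt (N j : nat) : (N < j)%nat -> half_coef N j = 0.
Proof.
intros H; unfold half_coef; rewrite rising_opp_nat by exact H; unfold Rdiv; ring.
Qed.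

Lemma half_coef_le (N j : nat) : (j <= N)%nat ->
  half_coef N j = 2 ^ N * rising (1 / 2) N / (INR (fact (N - j)) * INR (fact (N + j))).
Proof.
intros H; unfold half_coef; rewrite rising_opp_fact by exact H.
field; repeat split; apply INR_fact_neq_0.
Qed.

(** Coefficient form of [(N + 1) * divided_pow (S N) y = (1 + y) * divided_pow N y], using
    [2 y T_j = T_(j-1) + T_(j+1)]. The constant term, where both neighbours of index 0 are [T_1], is
    treated separately in [half_coef_mul_0]. *)
Lemma half_coef_mul (N j : nat) :
  (INR N + 1) * half_coef (S N) (S j)
  = half_coef N (S j) + (half_coef N j + half_coef N (S (S j))) / 2.
Proof.
unfold half_coef.
rewrite (rising_S_l (- INR (S N))).
replace (- INR (S N) + 1) with (- INR N) by (rewrite S_INR; ring).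
rewrite !Nat.add_succ_r, !Nat.add_succ_l, !fact_simpl, !mult_INR; cbn [rising pow].
rewrite !S_INR, !plus_INR.
pose proof (INR_fact_neq_0 N); pose proof (INR_fact_neq_0 (N + j)).
pose proof (pos_INR N); pose proof (pos_INR j).
field; repeat split; lra.
Qed.

Lemma half_coef_mul_0 (N : nat) :
  (INR N + 1) * half_coef (S N) 0 = half_coef N 0 + half_coef N 1.
Proof.
unfold half_coef.
rewrite !Nat.add_0_r, Nat.add_1_r, !fact_simpl, !mult_INR; cbn [rising pow].
rewrite !S_INR; simpl (INR 0).
pose proof (INR_fact_neq_0 N); pose proof (pos_INR N).
field; repeat split; lra.
Qed.

(** The integration rule [2 j a_j = b_(j-1) - b_(j+1)], applied to [divided_pow N] and its
    antiderivative [divided_pow (S N)]. *)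
Lemma half_coef_int (N j : nat) :
  2 * (INR j + 1) * half_coef (S N) (S j) = half_coef N j - half_coef N (S (S j)).
Proof.
unfold half_coef.
rewrite (rising_S_l (- INR (S N))).
replace (- INR (S N) + 1) with (- INR N) by (rewrite S_INR; ring).
rewrite !Nat.add_succ_r, !Nat.add_succ_l, !fact_simpl, !mult_INR; cbn [rising pow].
rewrite !S_INR, !plus_INR.
pose proof (INR_fact_neq_0 N); pose proof (INR_fact_neq_0 (N + j)).
pose proof (pos_INR N); pose proof (pos_INR j).
field; repeat split; lra.
Qed.

(** Doubling the sum and subtracting [g 0] gives the symmetric sum of [g |j| T_|j|] over
    [-M <= j <= M], on which multiplication by [2 y] adds the two shifts of [g]. The last term is
    the boundary error of the truncation at [M]. *)
Lemma chebT_sum_mul (g : nat -> R) (M : nat) (y : R) :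
  2 * y * (2 * sum_n (fun j => g j * chebT j y) M - g 0%nat)
  = 2 * sum_n (fun j => (match j with
                         | O => 2 * g 1%nat
                         | S i => g i + g (S j)
                         end) * chebT j y) M - 2 * g 1%nat
    + 2 * (g M * chebT (S M) y - g (S M) * chebT M y).
Proof.
induction M as [|M IH].
  rewrite !sum_O, chebT_0, chebT_1; ring.
rewrite !sum_n_S, chebT_rec.
match goal with |- _ = 2 * (?A + _) - _ + _ =>
  replace A with ((2 * y * (2 * sum_n (fun j => g j * chebT j y) M - g 0%nat)
    - 2 * (g M * chebT (S M) y - g (S M) * chebT M y)
    + 2 * g 1%nat) / 2) by (rewrite IH; field)
end.
field.
Qed.

Lemma divided_pow_half (N M : nat) (y : R) : (N <= M)%nat ->
  divided_pow N y = 2 * sum_n (fun j => half_coef N j * chebT j y) M - half_coef N 0.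
Proof.
induction N as [|N IH]; intros H.
  rewrite (sum_n_Rext _ (fun j => (if Nat.eqb j 0 then 1 else 0) * chebT j y)).
    rewrite sum_n_indicator, chebT_0 by lia.
    unfold divided_pow, half_coef; simpl; field.
  intros [|j] _; simpl Nat.eqb; [|rewrite half_coef_gt by lia; ring].
  unfold half_coef; simpl; field.
pose proof (pos_INR N).
apply Rmult_eq_reg_l with (INR N + 1); [|lra].
replace ((INR N + 1) * divided_pow (S N) y) with ((1 + y) * divided_pow N y).
2:{ unfold divided_pow; rewrite fact_simpl, mult_INR, S_INR; simpl.
    field; split; [apply INR_fact_neq_0|lra]. }
rewrite IH by lia.
pose proof (chebT_sum_mul (half_coef N) M y) as E.
(* Since [N < M], both boundary terms vanish. *)
rewrite (half_coef_gt N M), (half_coef_gt N (S M)) in E by lia.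
assert (E2 : (INR N + 1) * sum_n (fun j => half_coef (S N) j * chebT j y) M
  = sum_n (fun j => half_coef N j * chebT j y) M
    + / 2 * sum_n (fun j => (match j with
                             | O => 2 * half_coef N 1%nat
                             | S i => half_coef N i + half_coef N (S j)
                             end) * chebT j y) M).
  rewrite <- !sum_n_Rmult_l, <- sum_n_Rplus; apply sum_n_Rext.
  intros [|j] _; rewrite <- Rmult_assoc.
    rewrite half_coef_mul_0; field.
  rewrite half_coef_mul; field.
pose proof (half_coef_mul_0 N).
lra.
Qed.

(** The Neumann factor [2^(1 - delta_(0,j))]: only the constant coefficient is not doubled. *)
Definition cheb_weight (j : nat) : R := if Nat.eqb 0 j then 1 else 2.

Lemma divided_pow_chebT (N M : nat) (y : R) : (N <= M)%nat ->
  divided_pow N y = sum_n (fun j => cheb_weight j * half_coef N j * chebT j y) M.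
Proof.
intros H; rewrite (divided_pow_half N M y H); clear H.
induction M as [|M IH].
  rewrite !sum_O, chebT_0; unfold cheb_weight; simpl; ring.
rewrite !sum_n_S, <- IH; unfold cheb_weight; simpl; ring.
Qed.

(** * The beta integral for divided powers *)

Lemma is_derive_divided_pow (k : nat) (t : R) :
  is_derive (divided_pow (S k)) t (divided_pow k t).
Proof.
unfold divided_pow; rewrite fact_simpl, mult_INR, S_INR.
pose proof (INR_fact_neq_0 k) as Hc; revert Hc.
generalize (INR (fact k)); intros c Hc.
pose proof (pos_INR k).
auto_derive; [trivial|].
change (Nat.pred (S k)) with k; change (match k with O => 1 | S _ => INR k + 1 end)
  with (INR (S k)); rewrite S_INR.
field; split; lra.
Qed.

Lemma continuous_divided_pow (k : nat) (t : R) : continuous (divided_pow k) t.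
Proof.
apply (ex_derive_continuous (divided_pow k)); unfold divided_pow; auto_derive; trivial.
Qed.

Lemma divided_pow_neg1 (k : nat) : divided_pow (S k) (-1) = 0.
Proof.
unfold divided_pow; replace (1 + -1) with 0 by ring; simpl; unfold Rdiv; ring.
Qed.

(** Induction on [i]: each integration by parts lowers the exponent of the first factor and raises
    that of the second. *)
Lemma is_RInt_divided_pow (i k : nat) (x : R) :
  is_RInt (fun t => divided_pow i (x - t) * divided_pow k t) (-1) (x + 1)
    (divided_pow (i + k + 1) (x + 1)).
Proof.
revert k; induction i as [|i IH]; intros k.
  apply is_RInt_ext with (divided_pow k).
    intros t _; unfold divided_pow; simpl; field; apply INR_fact_neq_0.
  replace (divided_pow (0 + k + 1) (x + 1))
    with (minus (divided_pow (S k) (x + 1)) (divided_pow (S k) (-1))).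
  2:{ rewrite divided_pow_neg1; replace (0 + k + 1)%nat with (S k) by lia.
      apply Rminus_0_r. }
  apply (is_RInt_derive (divided_pow (S k))); intros t _.
    apply is_derive_divided_pow.
  apply continuous_divided_pow.
set (P := fun t => divided_pow (S i) (x - t) * divided_pow (S k) t).
replace (S i + k + 1)%nat with (i + S k + 1)%nat by lia.
replace (divided_pow (i + S k + 1) (x + 1))
  with (plus (minus (P (x + 1)) (P (-1))) (divided_pow (i + S k + 1) (x + 1))).
(* Both boundary terms vanish: at [t = x + 1] through the first factor, at [t = -1] through the
   second. *)
2:{ unfold P; replace (x - (x + 1)) with (-1) by ring; rewrite !divided_pow_neg1.
    unfold minus, plus, opp; simpl; ring. }
apply is_RInt_ext with (fun t => plus
  (divided_pow (S i) (x - t) * divided_pow k t - divided_pow i (x - t) * divided_pow (S k) t)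
  (divided_pow i (x - t) * divided_pow (S k) t)).
  intros t _; unfold plus; simpl; ring.
apply (is_RInt_plus (V := R_NormedModule)); [|apply IH].
assert (Hx : forall t, is_derive (fun t => x - t) t (-1)).
  intros t; auto_derive; [trivial|ring].
apply (is_RInt_derive P); intros t _.
  replace (divided_pow (S i) (x - t) * divided_pow k t
           - divided_pow i (x - t) * divided_pow (S k) t)
    with (-1 * divided_pow i (x - t) * divided_pow (S k) t
          + divided_pow (S i) (x - t) * divided_pow k t) by ring.
  apply (is_derive_mult (fun t => divided_pow (S i) (x - t))).
  - apply (is_derive_comp (divided_pow (S i)) (fun t => x - t)); [|apply Hx].
    apply is_derive_divided_pow.
  - apply is_derive_divided_pow.
  - exact Rmult_comm.
assert (Hc : forall l, continuous (fun t => divided_pow l (x - t)) t).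
  intros l; apply continuous_comp; [|apply continuous_divided_pow].
  apply (ex_derive_continuous (fun t => x - t)); exists (-1); apply Hx.
apply (continuous_minus (V := R_NormedModule)).
- apply (continuous_mult (fun t => divided_pow (S i) (x - t))); [apply Hc|].
  apply continuous_divided_pow.
- apply (continuous_mult (fun t => divided_pow i (x - t))); [apply Hc|].
  apply continuous_divided_pow.
Qed.

(** * Coefficients of iterated integrals and of the convolution *)

(* Half the coefficient of [T_j], [j > 0], in the [nu]-fold iterated integral of
   [T_n] from [-1]. *)
Definition int_coef (n nu j : nat) : R :=
  (-1) ^ n * sum_n (fun k => taylor_coef n k * half_coef (k + nu) j) n.

(** Convolving [T_n] with the [i]-th divided power integrates it [i + 1] times, hence the index
    [S i]. *)
Definition conv_coef (m n j : nat) : R :=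
  cheb_weight j * ((-1) ^ m * sum_n (fun i => taylor_coef m i * int_coef n (S i) j) m).

Lemma conv_coef_double_sum (m n j : nat) :
  conv_coef m n j
  = sum_n (fun i => sum_n (fun k => (-1) ^ m * (-1) ^ n * taylor_coef m i * taylor_coef n k
             * (cheb_weight j * half_coef (i + k + 1) j)) n) m.
Proof.
unfold conv_coef; rewrite <- Rmult_assoc, <- sum_n_Rmult_l.
apply sum_n_Rext; intros i _; unfold int_coef.
rewrite <- !Rmult_assoc, <- sum_n_Rmult_l.
apply sum_n_Rext; intros k _.
replace (k + S i)%nat with (i + k + 1)%nat by lia; ring.
Qed.

(** Commutativity of convolution. For [j <= m] it allows iterated integrals of [T_m] to be used in
    place of those of [T_n]. *)
Lemma conv_coef_sym (m n j : nat) : conv_coef m n j = conv_coef n m j.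
Proof.
rewrite !conv_coef_double_sum, sum_n_switch.
apply sum_n_Rext; intros k _; apply sum_n_Rext; intros i _.
replace (i + k + 1)%nat with (k + i + 1)%nat by lia; ring.
Qed.

Lemma conv_expansion_coef (m n : nat) : conv_expansion m n (conv_coef m n).
Proof.
intros x; apply is_RInt_unique.
set (c := fun i k => (-1) ^ m * (-1) ^ n * taylor_coef m i * taylor_coef n k).
apply is_RInt_ext with (fun t => sum_n (fun i => sum_n (fun k =>
   c i k * (divided_pow i (x - t) * divided_pow k t)) n) m).
  intros t _; rewrite !chebT_taylor.
  rewrite <- (sum_n_Rmult_l ((-1) ^ m)), <- sum_n_Rmult_r.
  apply sum_n_Rext; intros i _.
  rewrite <- !sum_n_Rmult_l.
  apply sum_n_Rext; intros k _; unfold c; ring.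
replace (sum_n (fun k => conv_coef m n k * chebT k (x + 1)) (m + n + 1))
  with (sum_n (fun i => sum_n (fun k => c i k * divided_pow (i + k + 1) (x + 1)) n) m).
  apply is_RInt_sum_n; intros i; apply is_RInt_sum_n; intros k.
  apply (is_RInt_scal (V := R_NormedModule)), is_RInt_divided_pow.
(* Every exponent [i + k + 1] is at most [m + n + 1], so all divided powers are expanded over one
   common range of [j], and the sums can be interchanged. *)
rewrite (sum_n_Rext (fun k => conv_coef m n k * _) (fun j => sum_n (fun i => sum_n (fun k =>
   c i k * (cheb_weight j * half_coef (i + k + 1) j * chebT j (x + 1))) n) m)).
  symmetry; rewrite sum_n_switch; apply sum_n_Rext; intros i Hi.
  rewrite sum_n_switch; apply sum_n_Rext; intros k Hk.
  rewrite (divided_pow_chebT _ (m + n + 1)) by lia.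
  rewrite <- sum_n_Rmult_l; reflexivity.
intros j _; rewrite conv_coef_double_sum, <- sum_n_Rmult_r.
apply sum_n_Rext; intros i _; rewrite <- sum_n_Rmult_r.
apply sum_n_Rext; intros k _; unfold c; ring.
Qed.

(** * Closed form for [nu <= j] *)

(** The 0-fold integral is [T_n] itself, so uniqueness of Chebyshev coefficients applies; the value
    [1 / 2] is the halved coefficient, as [n > 0]. *)
Lemma int_coef_0 (n j : nat) : (1 <= n)%nat ->
  int_coef n 0 j = if Nat.eqb j n then 1 / 2 else 0.
Proof.
intros Hn.
assert (H : cheb_weight j * int_coef n 0 j = if Nat.eqb j n then 1 else 0).
  apply (chebT_coef_unique (n + j) (fun j => cheb_weight j * int_coef n 0 j)
    (fun j => if Nat.eqb j n then 1 else 0)); [|lia].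
  intros y; rewrite sum_n_indicator by lia.
  rewrite chebT_taylor, <- sum_n_Rmult_l.
  rewrite (sum_n_Rext (fun k => _ * (taylor_coef n k * _))
    (fun k => sum_n (fun i => (-1) ^ n * taylor_coef n k
       * (cheb_weight i * half_coef k i * chebT i y)) (n + j))).
    rewrite sum_n_switch; apply sum_n_Rext; intros i _.
    unfold int_coef; rewrite <- !sum_n_Rmult_l, <- sum_n_Rmult_r.
    apply sum_n_Rext; intros k _; rewrite Nat.add_0_r; ring.
  intros k Hk; rewrite (divided_pow_chebT k (n + j)) by lia.
  rewrite <- !sum_n_Rmult_l; apply sum_n_Rext; intros i _; ring.
unfold cheb_weight in H.
destruct (Nat.eqb_spec j n), (Nat.eqb_spec 0 j); try lia; lra.
Qed.

Lemma int_coef_rec (n nu j : nat) :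
  2 * (INR j + 1) * int_coef n (S nu) (S j) = int_coef n nu j - int_coef n nu (S (S j)).
Proof.
unfold int_coef.
rewrite <- Rmult_minus_distr_l, <- sum_n_Rminus, !(Rmult_comm ((-1) ^ n)), <- Rmult_assoc.
rewrite <- sum_n_Rmult_l; f_equal; apply sum_n_Rext; intros k _.
rewrite Nat.add_succ_r, <- Rmult_minus_distr_l, <- half_coef_int; ring.
Qed.

(** The recurrence leads from [(S nu, S j)] to [(nu, j)] and [(nu, j + 2)], so it preserves both the
    region [nu <= j] and the parity of [n + nu - j]. The last hypothesis covers wrong parity as well
    as [j > n + nu]. *)
Lemma int_coef_out (n nu j : nat) : (1 <= n)%nat -> (nu <= j)%nat ->
  (forall p, (n + nu)%nat <> (j + 2 * p)%nat) -> int_coef n nu j = 0.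
Proof.
intros Hn; revert j; induction nu as [|nu IH]; intros j Hj Hp.
  rewrite int_coef_0 by exact Hn.
  destruct (Nat.eqb_spec j n) as [->|_]; [|reflexivity].
  exfalso; apply (Hp 0%nat); lia.
destruct j as [|j]; [lia|].
pose proof (int_coef_rec n nu j) as E.
rewrite (IH j), (IH (S (S j))) in E; try lia.
- pose proof (pos_INR j).
  apply Rmult_eq_reg_l with (2 * (INR j + 1)); lra.
- intros p Hq; apply (Hp (S p)); lia.
- intros p Hq; apply (Hp p); lia.
Qed.

(** Induction on [nu] through the recurrence. As [nu <= j] forces [2 p <= n], the subtraction
    [n - p - 1] is never truncated. *)
Lemma int_coef_in (n nu j p : nat) : (1 <= n)%nat -> (nu <= j)%nat ->
  (n + nu = j + 2 * p)%nat ->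
  2 * int_coef n nu j
  = INR n * rising (- INR nu) p * INR (fact (n - p - 1))
    / (2 ^ nu * INR (fact p) * INR (fact (j + p))).
Proof.
intros Hn; revert j p; induction nu as [|nu IH]; intros j p Hj Hp.
  rewrite int_coef_0 by exact Hn.
  destruct p as [|p].
    replace j with n by lia; rewrite Nat.eqb_refl, Nat.add_0_r, Nat.sub_0_r.
    destruct n as [|i]; [lia|].
    replace (S i - 1)%nat with i by lia.
    rewrite !fact_simpl, mult_INR; simpl rising; simpl pow; simpl (INR (fact 0)).
    field; split; [apply INR_fact_neq_0|apply not_0_INR; lia].
  destruct (Nat.eqb_spec j n); [lia|].
  rewrite (rising_opp_nat 0) by lia; unfold Rdiv; ring.
destruct j as [|j]; [lia|].
pose proof (int_coef_rec n nu j) as E.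
pose proof (pos_INR j).
apply Rmult_eq_reg_l with (2 * (INR j + 1)); [|lra].
replace (2 * (INR j + 1) * (2 * int_coef n (S nu) (S j)))
  with (2 * int_coef n nu j - 2 * int_coef n nu (S (S j))) by lra.
rewrite (IH j p) by lia.
assert (H2 : 2 ^ nu <> 0) by (apply pow_nonzero; lra).
(* For [p = 0] one has [j = n + nu], so the neighbour [j + 2] lies beyond the degree and contributes
   0. *)
destruct p as [|q].
  rewrite int_coef_out by (try intros p; lia).
  rewrite !Nat.add_0_r, (fact_simpl j), mult_INR, (S_INR j); simpl rising; simpl pow.
  pose proof (INR_fact_neq_0 j); pose proof (INR_fact_neq_0 0).
  field; repeat split; lra.
rewrite (IH (S (S j)) q) by lia.
rewrite (rising_S_l (- INR (S nu))).
replace (- INR (S nu) + 1) with (- INR nu) by (rewrite S_INR; ring).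
replace (n - q - 1)%nat with (S (n - S q - 1)) by lia.
rewrite !Nat.add_succ_r, !Nat.add_succ_l, !fact_simpl, !mult_INR; cbn [rising pow].
replace (S (n - S q - 1)) with (n - q - 1)%nat by lia.
rewrite !minus_INR by lia.
(* Eliminating [n] leaves a rational identity in the independent quantities [j], [q], [nu]. *)
assert (En : INR n = INR j + 2 * INR q + 2 - INR nu).
  replace n with (j + 2 * q + 2 - nu)%nat by lia.
  rewrite minus_INR, !plus_INR, mult_INR by lia; simpl; ring.
rewrite !S_INR, !plus_INR, En; simpl (INR 0).
pose proof (INR_fact_neq_0 q); pose proof (INR_fact_neq_0 (j + q)).
pose proof (pos_INR q).
field; repeat split; lra.
Qed.

(** For [j > n + nu] the degree is exceeded; for [j + nu < n] the factor [(-nu)_p] of the closed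
    form vanishes, because [p > nu]. *)
Lemma int_coef_far (n nu j : nat) : (1 <= n)%nat -> (nu <= j)%nat ->
  (j + nu < n \/ n + nu < j)%nat -> int_coef n nu j = 0.
Proof.
intros Hn Hj H.
destruct (Nat.Even_or_Odd (n + nu - j)) as [[p Hp]|[p Hp]].
  destruct H as [H|H]; [|apply int_coef_out; lia].
  pose proof (int_coef_in n nu j p Hn Hj ltac:(lia)) as E.
  rewrite (rising_opp_nat nu p) in E by lia.
  unfold Rdiv in E; lra.
apply int_coef_out; lia.
Qed.

(** * Identification with [varpi] and [dtil] *)

Lemma varpi_int_coef (m n j nu : nat) :
  (1 <= n)%nat -> (1 <= nu <= j)%nat -> (j <= n + nu)%nat ->
  varpi m n j nu = (-1) ^ m * taylor_coef m (nu - 1) * (2 * int_coef n nu j).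
Proof.
intros Hn Hj Hjn; unfold varpi.
destruct (Nat.Even_or_Odd (n + nu - j)) as [[p Hp]|[p Hp]].
  replace (Z.of_nat n + Z.of_nat nu - Z.of_nat j)%Z with (2 * Z.of_nat p)%Z by lia.
  rewrite Z.even_even.
  rewrite (int_coef_in n nu j p) by lia; unfold taylor_coef.
  replace (Z.of_nat n + Z.of_nat nu + Z.of_nat j)%Z with (2 * Z.of_nat (j + p))%Z by lia.
  rewrite !(Z.mul_comm 2), !Z.div_mul, Nat2Z.id by lia.
  rewrite (Z.mul_comm _ 2).
  replace (Z.of_nat nu - 1)%Z with (Z.of_nat (nu - 1)) by lia.
  rewrite !poch_nat.
  assert (Eg : poch (IZR (Z.of_nat p * 2 + 2) / 2) (Z.of_nat j - Z.of_nat nu - 1)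
               = INR (fact (n - p - 1)) / INR (fact p)).
    replace (IZR (Z.of_nat p * 2 + 2) / 2) with (INR p + 1)
      by (rewrite plus_IZR, mult_IZR, <- INR_IZR_INZ; field).
    (* For [j = nu] the index is -1 and the symbol is [(p + 1)_(-1) = 1 / p]; here [n = 2 p], so
       [p > 0]. *)
    destruct (Nat.eq_dec j nu) as [->|Hne].
      destruct p as [|p]; [lia|].
      replace (Z.of_nat nu - Z.of_nat nu - 1)%Z with (-1)%Z by lia.
      replace (n - S p - 1)%nat with p by lia.
      change (/ (1 * (INR (S p) + 1 + - 1 + 0)) = INR (fact p) / INR (fact (S p))).
      rewrite fact_simpl, mult_INR, S_INR.
      pose proof (pos_INR p); field; split; [apply INR_fact_neq_0|lra].
    replace (Z.of_nat j - Z.of_nat nu - 1)%Z with (Z.of_nat (j - nu - 1)) by lia.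
    rewrite poch_nat, rising_fact.
    replace (p + (j - nu - 1))%nat with (n - p - 1)%nat by lia; reflexivity.
  rewrite Eg.
  (* The factor [2^(nu - 1)] belongs to [taylor_coef], the factor [2^nu] to the closed form of
     [int_coef]. *)
  assert (Ep : powerRZ 2 (1 - 2 * Z.of_nat nu) = / (2 ^ (nu - 1) * 2 ^ nu)).
    rewrite <- pow_add.
    replace (1 - 2 * Z.of_nat nu)%Z with (- Z.of_nat (nu - 1 + nu))%Z by lia.
    rewrite powerRZ_neg', <- pow_powerRZ; reflexivity.
  rewrite Ep.
  assert (H2 : forall k, 2 ^ k <> 0) by (intros k; apply pow_nonzero; lra).
  field; repeat split; try apply H2; try apply INR_fact_neq_0; apply rising_half_neq_0.
replace (Z.of_nat n + Z.of_nat nu - Z.of_nat j)%Z with (2 * Z.of_nat p + 1)%Z by lia.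
rewrite Z.even_odd.
rewrite int_coef_out by lia; ring.
Qed.

Lemma dtil_int_coef (m n j nu : nat) : (j < nu)%nat ->
  dtil m n j nu
  = cheb_weight j * ((-1) ^ n * taylor_coef n (nu - 1) * int_coef m nu j).
Proof.
intros Hj; unfold dtil, pFq.
set (a := fun k => taylor_coef m k * half_coef (k + nu) j).
(* [q] is the term [a 0]; dividing by it normalises the sum to a hypergeometric series, whose
   parameter 1 cancels the factorial [k!]. *)
set (q := 2 ^ nu * rising (1 / 2) nu / (INR (fact (nu - j)) * INR (fact (j + nu)))).
assert (H2 : forall k, 2 ^ k <> 0) by (intros k; apply pow_nonzero; lra).
assert (Hq : q <> 0).
  unfold q, Rdiv; repeat apply Rmult_integral_contrapositive_currified;
    [apply H2|apply rising_half_neq_0|apply Rinv_neq_0_compat].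
  apply Rmult_integral_contrapositive_currified; apply INR_fact_neq_0.
assert (Enu : INR nu = INR (nu - j) + INR j) by (rewrite <- plus_INR; f_equal; lia).
assert (Eser : forall k, Rprod (map (fun z => poch z (Z.of_nat k))
     [1; - INR m; INR m; INR nu + 1 / 2])
   / Rprod (map (fun z => poch z (Z.of_nat k))
     [1 / 2; - INR j + INR nu + 1; INR j + INR nu + 1]) * (1 ^ k / INR (fact k))
   = / q * a k).
  intros k; unfold Rprod; cbn [map fold_right]; rewrite !poch_nat, pow1.
  replace (- INR j + INR nu + 1) with (INR (nu - j) + 1) by lra.
  replace (INR j + INR nu + 1) with (INR (j + nu) + 1) by (rewrite plus_INR; ring).
  replace (rising 1 k) with (INR (fact k)).
  2:{ replace 1 with (INR 0 + 1) by (simpl; ring).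
      rewrite rising_fact; simpl; field. }
  rewrite !rising_fact; unfold a, q, taylor_coef.
  rewrite half_coef_le by lia.
  replace (k + nu - j)%nat with (nu - j + k)%nat by lia.
  replace (k + nu + j)%nat with (j + nu + k)%nat by lia.
  rewrite (Nat.add_comm k nu), pow_add, rising_add.
  rewrite (Rplus_comm (1 / 2) (INR nu)).
  field; repeat split; try apply H2; try apply INR_fact_neq_0; apply rising_half_neq_0.
rewrite (Series_ext _ _ Eser).
rewrite (Series_finite _ m).
2:{ intros k Hk; unfold a, taylor_coef; rewrite rising_opp_nat by exact Hk.
    unfold Rdiv; ring. }
rewrite sum_n_Rmult_l; unfold int_coef; fold a.
replace (Z.of_nat nu - 1)%Z with (Z.of_nat (nu - 1)) by lia.
rewrite !poch_nat; unfold taylor_coef, q.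
(* The factor [nu - 1/2] of [dtil] is the quotient of [(1/2)_nu] in [q] by [(1/2)_(nu-1)] in
   [taylor_coef]. *)
destruct nu as [|nu]; [lia|].
replace (S nu - 1)%nat with nu by lia.
cbn [rising pow]; rewrite S_INR, pow_add.
pose proof (pos_INR nu).
unfold cheb_weight; destruct (Nat.eqb 0 j); simpl (2 ^ (2 - _));
field; repeat split; try apply H2; try apply INR_fact_neq_0;
  try apply rising_half_neq_0; lra.
Qed.

(** * The three ranges of [j] *)

Lemma conv_coef_sum_n_m (m n j : nat) :
  conv_coef m n j = sum_n_m (fun nu =>
    cheb_weight j * ((-1) ^ m * taylor_coef m (nu - 1) * int_coef n nu j)) 1 (m + 1).
Proof.
replace (m + 1)%nat with (S m) by lia.
rewrite <- sum_n_m_S.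
change (conv_coef m n j = sum_n (fun i =>
  cheb_weight j * ((-1) ^ m * taylor_coef m (S i - 1) * int_coef n (S i) j)) m).
unfold conv_coef; rewrite <- !sum_n_Rmult_l.
apply sum_n_Rext; intros i _; replace (S i - 1)%nat with i by lia; ring.
Qed.

Lemma sum_n_m_Rext (f g : nat -> R) (a b : nat) :
  (forall k, (a <= k <= b)%nat -> f k = g k) -> sum_n_m f a b = sum_n_m g a b :> R.
Proof. exact (sum_n_m_ext_loc f g a b). Qed.

Lemma sum_n_m_zero_loc (f : nat -> R) (a b : nat) :
  (forall k, (a <= k <= b)%nat -> f k = 0) -> sum_n_m f a b = 0 :> R.
Proof.
intros H; rewrite (sum_n_m_Rext f (fun _ => 0)) by exact H.
exact (sum_n_m_const_zero a b).
Qed.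

Theorem corollary3p12 (m n : nat) (hm : (1 <= m)%nat) (hmn : (m <= n)%nat) :
  (exists rho : nat -> R, conv_expansion m n rho) /\
  (forall rho : nat -> R, conv_expansion m n rho ->
   forall j : nat, (j <= m + n + 1)%nat ->
     ((Z.max (Z.of_nat m + 1) (Z.of_nat n - Z.of_nat m - 1) <= Z.of_nat j)%Z ->
        rho j = sum_n_m (fun nu => varpi m n j nu)
                  (Nat.max 1 (Z.abs_nat (Z.of_nat j - Z.of_nat n))) (m + 1)) /\
     ((2 * m + 3 <= n)%nat -> (m + 1 <= j)%nat -> (j <= n - m - 2)%nat ->
        rho j = 0) /\
     ((j <= m)%nat ->
        rho j = sum_n_m (fun nu => varpi n m j nu) 1 j
                + sum_n_m (fun nu => dtil m n j nu) (j + 1) (n + 1))).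
Proof.
split; [exists (conv_coef m n); apply conv_expansion_coef|].
intros rho Hrho j Hj.
assert (Ej : rho j = conv_coef m n j).
  apply (chebT_coef_unique (m + n + 1)); [|exact Hj].
  intros y; replace y with (y - 1 + 1) by ring.
  rewrite <- (Hrho (y - 1)); apply conv_expansion_coef.
rewrite Ej; clear rho Hrho Ej; split; [|split].
- intros H; rewrite conv_coef_sum_n_m.
  set (a := Nat.max 1 (Z.abs_nat (Z.of_nat j - Z.of_nat n))).
  assert (Ew : cheb_weight j = 2) by (destruct j; [lia|reflexivity]).
  rewrite (sum_n_m_Rext (fun nu => varpi m n j nu) (fun nu =>
    cheb_weight j * ((-1) ^ m * taylor_coef m (nu - 1) * int_coef n nu j))).
  2:{ intros nu Hnu; rewrite varpi_int_coef by lia; rewrite Ew; ring. }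
  (* If [a > 1] then [a = |j - n|], and the terms with [nu < a] vanish by [int_coef_far], whose
     condition [nu <= j] follows from [nu <= m + 1 <= j]. *)
  destruct (Nat.eq_dec a 1) as [->|Ha]; [reflexivity|].
  rewrite (sum_n_m_Chasles _ 1 (a - 1) (m + 1)) by lia.
  replace (S (a - 1)) with a by lia.
  rewrite (sum_n_m_zero_loc _ 1 (a - 1)); [apply Rplus_0_l|].
  intros nu Hnu; rewrite int_coef_far by lia; ring.
- intros H1 H2 H3; rewrite conv_coef_sum_n_m; apply sum_n_m_zero_loc.
  (* Here [j + nu <= (n - m - 2) + (m + 1) < n]. *)
  intros nu Hnu; rewrite int_coef_far by lia; ring.
- intros H; rewrite conv_coef_sym, conv_coef_sum_n_m.
  (* The closed form holds up to [nu = j]; beyond it the hypergeometric form takes over. For [j = 0]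
     the first sum is empty. *)
  rewrite (sum_n_m_Chasles _ 1 j (n + 1)) by lia.
  apply (f_equal2 Rplus).
    apply sum_n_m_Rext; intros nu Hnu.
    rewrite varpi_int_coef by lia.
    replace (cheb_weight j) with 2 by (destruct j; [lia|reflexivity]); ring.
  replace (j + 1)%nat with (S j) by lia.
  apply sum_n_m_Rext; intros nu Hnu; rewrite dtil_int_coef by lia; reflexivity.
Qed.
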